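(* Let $G$ be a group of $K$-linear Markov type for some field $K$. Then $G$ is Noetherian. In particular, $G$ is finitely generated.
   Context: For a finite-dimensional $K$-vector space $A$, $A^G$ is the $K$-vector space of all maps $x \colon G \to A$, equipped with the prodiscrete topology (product topology with each factor $A$ discrete) and with the shift action $(gx)(h) = x(g^{-1}h)$. A linear subshift of $A^G$ is a closed $G$-invariant vector subspace of $A^G$. A subset $\Sigma \subset A^G$ is a subshift of finite type (SFT) if there exist a finite subset $D \subset G$ and a subset $P \subset A^D$ such that $\Sigma = \{x \in A^G : (g^{-1}x)|_D \in P \text{ for all } g \in G\}$. A group $G$ is of $K$-linear Markov type if, for every finite-dimensional vector space $A$ over $K$, every linear subshift $\Sigma \subset A^G$ is an SFT. A group is Noetherian if it satisfies the maximal condition on subgroups, i.e., every ascending sequence of subgroups eventually stabilizes (equivalently, all of its subgroups are finitely generated). *)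

(* Defs.v *)
From HB Require Import structures.
From mathcomp Require Import all_boot all_order all_algebra.
From mathcomp Require Import all_classical.
From mathcomp Require Import topology function_spaces.

Set Implicit Arguments.
Unset Strict Implicit.
Unset Printing Implicit Defensive.

Import GRing.Theory.

Local Open Scope classical_set_scope.

Definition is_subgroup (G : groupType) (H : set G) : Prop :=
  group_closed (mem H).

(* Maximal condition on subgroups, in its ascending-chain form. *)
Definition noetherian_group (G : groupType) : Prop :=
  forall H : nat -> set G,
    (forall n, is_subgroup (H n)) ->
    (forall n, H n `<=` H n.+1) ->
    exists N : nat, forall n : nat, (N <= n)%N -> H n = H N.

Definition finitely_generated_group (G : groupType) : Prop :=
  exists S : set G,
    finite_set S /\ smallest (@is_subgroup G) S = [set: G].

Definition shift (G : groupType) (A : Type) (g : G) (x : G -> A) : G -> A :=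
  fun h => x (g^-1 * h)%g.

(* Closedness is taken for the prodiscrete topology: [{ptws _ -> _}] is the
   product topology, and [discrete_topology A] is [A] as a discrete space. *)
Definition linear_subshift (K : fieldType) (G : groupType) (A : vectType K)
    (Sigma : set (G -> A)) : Prop :=
  [/\ closed (Sigma : set {ptws G -> discrete_topology A}),
      forall (g : G) (x : G -> A), Sigma x -> Sigma (shift g x)
    & GRing.submod_closed (mem Sigma)].

(* [sigL D x : D -> A] is the restriction of [x] to [D]. *)
Definition sft (G : groupType) (A : Type) (Sigma : set (G -> A)) : Prop :=
  exists (D : set G) (P : set (D -> A)),
    finite_set D /\
    Sigma = [set x | forall g : G, P (sigL D (shift g^-1%g x))].

Definition linear_markov_type (K : fieldType) (G : groupType) : Prop :=
  forall (A : vectType K) (Sigma : set (G -> A)),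
    linear_subshift Sigma -> sft Sigma.

(* Main.v *)
(* For a subgroup [H] of [G], the maps [G -> K] that are constant on the left
   cosets of [H] form a linear subshift. If it is of finite type with window
   [D], and [H] is the union of an ascending chain [H_n], then finiteness of
   [D^-1 D] gives an [n] such that [D^-1 D] meets [H] inside [H_n]. Every
   pattern seen through a translate of [D] by the indicator function of [H_n]
   then extends to a map constant on the left cosets of [H]; hence this
   indicator function belongs to the subshift, which forces [H = H_n]. *)

Require Import Defs.
From HB Require Import structures.
From mathcomp Require Import all_boot all_order all_algebra.
From mathcomp Require Import all_classical.
From mathcomp Require Import topology function_spaces.

Set Implicit Arguments.
Unset Strict Implicit.
Unset Printing Implicit Defensive.

Import GRing.Theory.

Local Open Scope classical_set_scope.

Section Subgroups.
Variable G : groupType.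
Implicit Types (H S : set G).

Lemma is_subgroupP H :
  is_subgroup H <-> H 1%g /\ forall a b, H a -> H b -> H (a / b)%g.
Proof.
split=> -[H1 HV]; split.
- by move: H1; rewrite inE.
- by move=> a b Ha Hb; have := HV a b; rewrite !inE; apply.
- by rewrite inE.
- by move=> a b; rewrite !inE; apply: HV.
Qed.

Lemma subgroup1 H : is_subgroup H -> H 1%g.
Proof. by case/is_subgroupP. Qed.

Lemma subgroupV H a : is_subgroup H -> H a -> H a^-1%g.
Proof. by case/is_subgroupP=> H1 HV Ha; rewrite -[a^-1%g]mul1g; exact: HV. Qed.

Lemma subgroupM H a b : is_subgroup H -> H a -> H b -> H (a * b)%g.
Proof.
move=> sH Ha Hb; rewrite -[b]invgK; case/is_subgroupP: (sH) => _; apply=> //.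
exact: subgroupV.
Qed.

Lemma is_subgroup_smallest S : is_subgroup (smallest (@is_subgroup G) S).
Proof.
apply/is_subgroupP; split=> [M [/subgroup1]//|a b Sa Sb M SM].
by case/is_subgroupP: (SM.1) => _; apply; [apply: Sa | apply: Sb].
Qed.

Lemma chain_le (H : nat -> set G) :
  (forall n, H n `<=` H n.+1) -> forall m n, (m <= n)%N -> H m `<=` H n.
Proof.
move=> Hs m n /subnK <-; elim: (n - m)%N => [|k IH] //.
by apply: subset_trans IH _; rewrite addSn; exact: Hs.
Qed.

Lemma is_subgroup_bigcup_chain (H : nat -> set G) :
  (forall n, is_subgroup (H n)) -> (forall n, H n `<=` H n.+1) ->
  is_subgroup (\bigcup_n H n).
Proof.
move=> sH Hs; apply/is_subgroupP; split.
  by exists 0%N => //; exact: subgroup1.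
move=> a b [m _ Ha] [n _ Hb]; exists (maxn m n) => //.
apply: subgroupM; [exact: sH| |apply: subgroupV; first exact: sH].
  by apply: (chain_le Hs) Ha; exact: leq_maxl.
by apply: (chain_le Hs) Hb; exact: leq_maxr.
Qed.

Lemma finite_subset_bigcup_chain (H : nat -> set G) S :
  (forall n, H n `<=` H n.+1) -> finite_set S -> S `<=` \bigcup_n H n ->
  exists n, S `<=` H n.
Proof.
move=> Hs /finite_seqP[s ->]; elim: s => [|a s IH] sH; first by exists 0%N.
have [|m sm] := IH.
  by move=> b bs; apply: sH; rewrite /= inE orbC bs.
have [n _ Ha] := sH a (mem_head _ _).
exists (maxn m n) => b /=; rewrite inE => /orP[/eqP->|bs].
  by apply: (chain_le Hs) Ha; exact: leq_maxr.
by apply: (chain_le Hs) (sm b bs); exact: leq_maxl.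
Qed.

(** If no finite list generates [G], adjoining a missed element again and again gives a chain of
    subgroups that never stabilizes. *)
Lemma noetherian_finitely_generated :
  noetherian_group G -> finitely_generated_group G.
Proof.
move=> noeth; apply: contrapT => nfg.
have miss (s : seq G) : exists g, ~ smallest (@is_subgroup G) [set` s] g.
  apply: contrapT => /forallNP all_in; apply: nfg; exists [set` s].
  split; first exact: finite_seq.
  by apply/seteqP; split=> // g _; apply: contrapT; exact: all_in.
have [f fP] := choice miss.
pose s n := iter n (fun s => f s :: s) [::].
pose H n := smallest (@is_subgroup G) [set` s n].
have [||N HN] := noeth H.
- by move=> n; exact: is_subgroup_smallest.
- move=> n; apply: sub_smallest2r; first exact: is_subgroup_smallest.
  by move=> a /= sa; rewrite inE sa orbT.
(* [f (s N)] heads the list [s N.+1], so it lies in [H N.+1 = H N], against its choice. *)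
apply: (fP (s N)); rewrite -[smallest _ _]/(H N) -(HN N.+1) //.
by apply: sub_gen_smallest => /=; exact: mem_head.
Qed.

End Subgroups.

Section CosetConstant.
Variables (K : fieldType) (G : groupType).

(** Invariance is under right multiplication because that commutes with the left shift action. *)
Definition coset_constant (A : Type) (H : set G) : set (G -> A) :=
  [set x | forall g h, H h -> x (g * h)%g = x g].

(** Each defining equation involves two coordinates only, and a point of the closure agrees with
    some member of the set at both. *)
Lemma closed_coset_constant (A : choiceType) (H : set G) :
  closed (coset_constant H : set {ptws G -> discrete_topology A}).
Proof.
move=> x clx g h Hh.
have nx k : nbhs (x : {ptws G -> discrete_topology A})
    [set y : {ptws G -> discrete_topology A} | y k = x k].
  apply: (@proj_continuous G (fun=> discrete_topology A) k x [set x k]).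
  exact: discrete_set1.
have [y [yH [/= y1 y2]]] := clx _ (filterI (nx (g * h)%g) (nx g)).
by rewrite -y1 -y2; exact: yH.
Qed.

Lemma linear_subshift_coset_constant (A : vectType K) (H : set G) :
  linear_subshift (coset_constant H : set (G -> A)).
Proof.
split; first exact: closed_coset_constant.
- by move=> g x xH k h Hh; rewrite /shift mulgA; exact: xH.
- split=> [|a x y]; rewrite !inE // => xH yH g h Hh.
  by rewrite !fctE xH // yH.
Qed.

(** The set [F] is the part of [D^-1 D] inside [H]: once [H'] contains [F], two points of [D] in one
    left coset of [H] are in one left coset of [H']. *)
Lemma sft_coset_constant (A : nmodType) (H : set G) :
  is_subgroup H -> sft (coset_constant H : set (G -> A)) ->
  exists2 F : set G, finite_set F /\ F `<=` H &
    forall H' : set G, F `<=` H' ->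
      coset_constant H' `<=` (coset_constant H : set (G -> A)).
Proof.
move=> sH [D [P [finD SigmaE]]].
exists ([set (a^-1 * b)%g | a in D & b in D] `&` H); first split.
- by apply: finite_setIl; exact: finite_image2.
- exact: subIsetr.
move=> H' FH' x xH'; rewrite SigmaE => g /=.
pose near_D k d := D d /\ H (d^-1 * k)%g.
(* [y] spreads the pattern of [x] on [g D] along the left cosets of [H] that meet [D]; on all other
   cosets it is 0. *)
pose y k := if pselect (exists d, near_D k d) is left e
            then x (g * sval (cid e))%g else 0%R.
(* The value does not depend on the representative: [d'^-1 * d] lies in [F], hence in [H']. *)
have yE k d : near_D k d -> y k = x (g * d)%g.
  move=> [Dd Hdk]; rewrite /y; case: pselect => [e|[]]; last by exists d.
  case: cid => d' [Dd' Hd'k] /=.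
  rewrite -[in RHS](mulVKg d' d) mulgA; apply/esym/xH'/FH'; split.
    by exists d' => //; exists d.
  have -> : (d'^-1 * d = d'^-1 * k * (d^-1 * k)^-1)%g.
    by rewrite invgM invgK mulgA mulgK.
  by apply: subgroupM => //; exact: subgroupV.
have yH : coset_constant H y.
  move=> k h Hh.
  have [[d kd]|nk] := pselect (exists d, near_D k d).
    rewrite (yE _ _ kd); apply: yE; split; first exact: kd.1.
    by rewrite mulgA; apply: subgroupM => //; exact: kd.2.
  (* If the coset of [k] misses [D], so does that of [k * h], and both values are the default 0. *)
  rewrite /y; case: pselect => [e|_]; last by case: pselect.
  case: nk; case: e => d [Dd Hd]; exists d; split=> //.
  rewrite -[k](mulgK h) mulgA; apply: subgroupM => //; exact: subgroupV.
(* On [D], [y] coincides with the shift of [x] by [g^-1], so the pattern of [y] at the identity is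
   that of [x] at [g]. *)
have : P (sigL D (shift 1^-1 y)%g).
  by move: yH; rewrite SigmaE; apply.
congr P; apply/funext => d; rewrite /= /shift !invgK mul1g.
apply: yE; split; first exact: set_valP.
by rewrite mulVg; exact: subgroup1.
Qed.

End CosetConstant.

Lemma linear_markov_type_noetherian (K : fieldType) (G : groupType) :
  linear_markov_type K G -> noetherian_group G.
Proof.
move=> markov H sH Hs.
have sU := is_subgroup_bigcup_chain sH Hs.
have [F [finF FU] FP] :=
  sft_coset_constant sU (markov K^o _ (linear_subshift_coset_constant _ _)).
have [N FN] := finite_subset_bigcup_chain Hs finF FU.
exists N => n leNn; apply/seteqP; split; last exact: chain_le.
move=> h Hh.
pose x g : K^o := (g \in H N)%:R%R.
have : coset_constant (H N) x.
  move=> g k Hk; rewrite /x; congr (_%:R)%R; congr nat_of_bool.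
  apply/idP/idP; rewrite !inE => Hg; last exact: subgroupM.
  rewrite -[g](mulgK k); apply: subgroupM => //; exact: subgroupV.
(* The indicator [x] is now constant on the whole union, so its value at [h] is its value 1 at the
   identity; as 1 is not 0 in [K], [h] lies in [H N]. *)
move/(FP _ FN)/(_ 1%g h).
have h1 : (1%g \in H N) by rewrite inE; exact: subgroup1.
rewrite mul1g /x h1 => /(_ (ex_intro2 _ _ n I Hh)).
have [|_ /eqP] := boolP (h \in H N); first by rewrite inE.
by rewrite eq_sym oner_eq0.
Qed.

Theorem corollary6p1 (K : fieldType) (G : groupType) :
  linear_markov_type K G ->
  noetherian_group G /\ finitely_generated_group G.
Proof.
move=> /linear_markov_type_noetherian noeth.
by split=> //; exact: noetherian_finitely_generated.
Qed.
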